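(* For any $k\ge1$ and any weak composition $\mu\in\mathbb{Z}_{\ge0}^k$, one has $E_\mu=\Psi_{\mathcal{F}(\mu)}$ in $\mathbb{Q}(q,t)[x_1,\dots,x_k]$, where $E_\mu$ is the non-symmetric Macdonald polynomial, $\mathcal{F}(\mu)$ is the Dyckification of $\mu$, and $\Psi_\delta$ denotes the Dyck path Macdonald polynomial of a Dyck path $\delta$.
   Context: **Non-symmetric Macdonald polynomial.** For $\mu\in\mathbb{Z}_{\ge0}^k$ let $dg'(\mu)=\{(i,j):1\le i\le k,\ 1\le j\le\mu_i\}$ ($i$ column, $j$ row), $\widehat{dg}(\mu)=dg'(\mu)\cup\{(i,0):1\le i\le k\}$. A filling is $\sigma:dg'(\mu)\to\{1,\dots,k\}$; $\widehat\sigma$ extends it by $\widehat\sigma(i,0)=i$. Two distinct boxes attack each other if they are in the same row, or in consecutive rows with the lower box in a column strictly to the right of that of the upper box. $\sigma$ is non-attacking if $\widehat\sigma(u)\neq\widehat\sigma(v)$ for all attacking $u,v\in\widehat{dg}(\mu)$. For $u=(i,j)\in dg'(\mu)$: $d(u)=(i,j-1)$, $l(u)=\mu_i-j$, $a(u)=\#\{(i',j)\in dg'(\mu):i'<i,\mu_{i'}\le\mu_i\}+\#\{(i',j-1)\in\widehat{dg}(\mu):i'>i,\mu_{i'}<\mu_i\}$. $\mathrm{Des}(\widehat\sigma)=\{u\in dg'(\mu):\widehat\sigma(u)>\widehat\sigma(d(u))\}$; $\mathrm{Inv}(\widehat\sigma)$ is the set of attacking pairs $u,v\in\widehat{dg}(\mu)$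 with $u$ before $v$ in reading order (rows top to bottom, right to left in each row) and $\widehat\sigma(u)>\widehat\sigma(v)$. $\mathrm{maj}(\widehat\sigma)=\sum_{u\in\mathrm{Des}(\widehat\sigma)}(l(u)+1)$, $\mathrm{inv}(\widehat\sigma)=|\mathrm{Inv}(\widehat\sigma)|-|\{i<j:\mu_i\le\mu_j\}|-\sum_{u\in\mathrm{Des}(\widehat\sigma)}a(u)$, $\mathrm{coinv}(\widehat\sigma)=\sum_{u\in dg'(\mu)}a(u)-\mathrm{inv}(\widehat\sigma)$. With $x^\sigma=\prod_{u\in dg'(\mu)}x_{\sigma(u)}$, $$E_\mu=\sum_{\sigma\ \text{non-attacking}}x^\sigma q^{\mathrm{maj}(\widehat\sigma)}t^{\mathrm{coinv}(\widehat\sigma)}\prod_{u\in dg'(\mu),\ \widehat\sigma(u)\ne\widehat\sigma(d(u))}\frac{1-t}{1-q^{l(u)+1}t^{a(u)+1}}.$$ **Dyck graph, Dyckification.** A Dyck path $\delta$ of length $n$ is a lattice path from $(0,0)$ to $(n,n)$ with unit north ($N$) and east ($E$) steps staying weakly above $y=x$. $G_\delta$ is the graph on $[n]$ with $i<j$ adjacent iff $(i-1,j)$ is on or below $\delta$. Label each box of $\widehat{dg}(\mu)$ by $EN$ if there is a box directly above it, else by $E$; $\mathcal{F}(\mu)$ is the Dyck path consisting of $k$ north steps followed by the labels read row by row, bottom to top, left to right in each row. **Dyck path statistics.** Let $\delta$ be a Dyck path of length $n$ with exactly $k$ initial north steps. The column graph $C_\delta$ is the directed graph on $[n]$ with an edge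 $j\to i$ whenever $i<j$ and $i$ is the largest number less than $j$ with $\{i,j\}$ not an edge of $G_\delta$; then write $d(j)=i$. (So $d(j)$ is defined exactly for $j\ge k+1$, and $1,\dots,k$ are the sinks.) For $i\ge k+1$, $l(i)$ is the number of $j>i$ having a directed path to $i$ in $C_\delta$. The connected components of $C_\delta$ are the columns $C_1,\dots,C_k$ (with $j\in C_j$ for $1\le j\le k$), and $\mathrm{ht}(i)=|C_j|$ if $i\in C_j$. The bounce path $b_\delta$ starts at $(0,0)$ and successively goes north as far as possible without leaving the region on or below $\delta$, then east to the diagonal, and repeats; it partitions $[n]$ into consecutive intervals (rows) $R_1,\dots,R_r$, the maximal cliques of the Dyck graph of $b_\delta$. $\mathrm{arm}(i)$ is the set of $1\le j<i$ such that either $i,j$ are in the same row and $\mathrm{ht}(j)\le\mathrm{ht}(i)$, or $i,j$ are adjacent in $G_\delta$, not in the same row, and $\mathrm{ht}(j)<\mathrm{ht}(i)$; $a(i)=|\mathrm{arm}(i)|$. For $f:[n]\to\mathbb{N}$: $\mathrm{Des}(f)=\{j\ge k+1:f(j)>f(d(j))\}$; $\mathrm{Inv}(f)$ is the set of pairs $i<j$ adjacent in $G_\delta$ with $f(i)<f(j)$; $\mathrm{maj}(f)=\sum_{i\in\mathrm{Des}(f)}(l(i)+1)$; $\mathrm{inv}(f)=|\mathrm{Inv}(f)|-|\{1\le i<j\le k:\mathrm{ht}(i)\le\mathrm{ht}(j)\}|-\sum_{i\in\mathrm{Des}(f)}a(i)$; $\mathrm{coinv}(f)=\sum_{i\ge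 k+1}a(i)-\mathrm{inv}(f)$. **Dyck path Macdonald polynomial.** Let $C_k(G_\delta,c_\delta)$ be the set of proper colorings $f:[n]\to[k]$ of $G_\delta$ with $f(i)=i$ for $1\le i\le k$, and for such $f$ let $x^f=\prod_{i\ge k+1}x_{f(i)}$. Then $$\Psi_\delta=\sum_{f\in C_k(G_\delta,c_\delta)}x^fq^{\mathrm{maj}(f)}t^{\mathrm{coinv}(f)}\prod_{i\ge k+1,\ f(i)\ne f(d(i))}\frac{1-t}{1-q^{l(i)+1}t^{a(i)+1}}.$$ *)

(* Defs.v *)
From HB Require Import structures.
From mathcomp Require Import all_boot all_order all_algebra.
From mathcomp.multinomials Require Import mpoly.

Set Implicit Arguments.
Unset Strict Implicit.
Unset Printing Implicit Defensive.

Import GRing.Theory.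

(* All indices are 0-based: the vertex, column or colour written m in the
   mathematical text (m >= 1) is the ordinal of value m - 1.  Rows of diagrams
   keep their original numbering, row 0 being the basement. *)

Definition Qqt := {fraction {mpoly rat[2]}}.
Definition qvar : Qqt := tofrac 'X_(ord0 : 'I_2).
Definition tvar : Qqt := tofrac 'X_(ord_max : 'I_2).

Definition hhl_factor (l a : nat) : Qqt :=
  ((1 - tvar) / (1 - qvar ^+ l.+1 * tvar ^+ a.+1))%R.

Section Macdonald.
Variables (k : nat) (mu : 'I_k -> nat).

(* The augmented diagram: column i has boxes in rows 0, ..., mu i. *)
Definition box : finType := {i : 'I_k & 'I_(mu i).+1}.
Definition bcol (u : box) : 'I_k := tag u.
Definition brow (u : box) : nat := tagged u.

Definition diagram : {set box} := [set u | 0 < brow u].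

(* d(u); only meaningful for u in the diagram. *)
Definition below (u : box) : box :=
  Tagged (fun i => 'I_(mu i).+1) (inord (brow u).-1 : 'I_(mu (bcol u)).+1).

Definition leg (u : box) : nat := mu (bcol u) - brow u.
Definition arm (u : box) : nat :=
  #|[set v in diagram | [&& brow v == brow u, bcol v < bcol u
                          & mu (bcol v) <= mu (bcol u)]]|
  + #|[set v : box | [&& (brow v).+1 == brow u, bcol u < bcol v
                       & mu (bcol v) < mu (bcol u)]]|.

Definition low_right (u v : box) : bool :=
  ((brow v).+1 == brow u) && (bcol u < bcol v).
Definition attack (u v : box) : bool :=
  (u != v) && [|| brow u == brow v, low_right u v | low_right v u].

(* Reading order: rows from top to bottom, right to left in each row. *)
Definition before (u v : box) : bool :=
  (brow v < brow u) || (brow u == brow v) && (bcol v < bcol u).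

Definition base_pairs : {set 'I_k * 'I_k} :=
  [set p : 'I_k * 'I_k | (p.1 < p.2) && (mu p.1 <= mu p.2)].

Definition filling := {ffun {u : box | u \in diagram} -> 'I_k}.

Definition augment (s : filling) (u : box) : 'I_k :=
  if insub u is Some v then s v else bcol u.

Definition nonattacking (s : filling) : bool :=
  [forall u, forall v, attack u v ==> (augment s u != augment s v)].

Section Stat.
Variable f : box -> 'I_k.
Definition Des : {set box} := [set u in diagram | f (below u) < f u].
Definition Inv : {set box * box} :=
  [set p | [&& attack p.1 p.2, before p.1 p.2 & f p.2 < f p.1]].
Definition maj : nat := \sum_(u in Des) (leg u).+1.
Definition binv : int :=
  (#|Inv|%:Z - #|base_pairs|%:Z - (\sum_(u in Des) arm u)%N%:Z)%R.
Definition coinv : int := ((\sum_(u in diagram) arm u)%N%:Z - binv)%R.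
End Stat.

Definition macdonald : {mpoly Qqt[k]} :=
  (\sum_(s : filling | nonattacking s)
     (qvar ^+ maj (augment s) * tvar ^ coinv (augment s)
      * \prod_(u in diagram | augment s u != augment s (below u))
          hhl_factor (leg u) (arm u))
     *: \prod_(u : {u : box | u \in diagram}) 'X_(s u))%R.

End Macdonald.

Definition Nstep : bool := true.
Definition Estep : bool := false.

Definition is_dyck (n : nat) (d : seq bool) : bool :=
  [&& count_mem Nstep d == n, count_mem Estep d == n &
      [forall m : 'I_(size d).+1,
         count_mem Estep (take m d) <= count_mem Nstep (take m d)]].

(* Dyck paths of length n with exactly k initial north steps. *)
Record dyck_path (n k : nat) := DyckPath {
  steps :> seq bool;
  steps_dyck : is_dyck n steps;
  steps_init : index Estep steps == k
}.

Definition on_or_below (d : seq bool) (x y : nat) : bool :=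
  [exists m : 'I_(size d).+1,
     (count_mem Estep (take m d) == x) && (y <= count_mem Nstep (take m d))].

(* With i 0-based, the point attached to the edge {i < j} is
   (i, j + 1). *)
Definition dyck_adj (n : nat) (d : seq bool) : rel 'I_n :=
  [rel i j : 'I_n |
     (i < j) && on_or_below d i j.+1 || (j < i) && on_or_below d j i.+1].

Section Bounce.
Variables (n : nat) (d : seq bool).

Definition peak (x : nat) : nat := \max_(y < n.+1 | on_or_below d x y) y.

(* The bounce path from (p,p), cut after m bounces; when d is a Dyck path of
   length n, every bounce makes progress until (n,n) is reached, so n bounces
   from (0,0) are enough. *)
Fixpoint bounce_from (m p : nat) : seq bool :=
  if m is m'.+1 then
    nseq (peak p - p) Nstep ++ nseq (peak p - p) Estep ++ bounce_from m' (peak p)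
  else [::].
Definition bounce : seq bool := bounce_from n 0.
End Bounce.

Definition clique (T : finType) (e : rel T) (R : {set T}) : bool :=
  [forall i in R, forall j in R, (i != j) ==> e i j].

(* The rows of d are the maximal cliques of the graph of its bounce path. *)
Definition is_row (n : nat) (d : seq bool) (R : {set 'I_n}) : bool :=
  maxset (clique (@dyck_adj n (bounce n d))) R.

Section DyckMacdonald.
Variables (n k : nat) (d : dyck_path n k).

Notation adj := (@dyck_adj n d).

(* cedge j i: the edge j -> i of the column graph. *)
Definition cedge : rel 'I_n :=
  [rel j i : 'I_n | [&& i < j, ~~ adj i j &
                 [forall h : 'I_n, (i < h) && (h < j) ==> adj h j]]].

(* d(j); the default value j is only taken at the sinks of the column graph. *)
Definition dbelow (j : 'I_n) : 'I_n := odflt j [pick i | cedge j i].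

Definition dleg (i : 'I_n) : nat :=
  #|[set j : 'I_n | (i < j) && connect cedge j i]|.

Definition ht (i : 'I_n) : nat :=
  #|[set j | connect [rel a b | cedge a b || cedge b a] i j]|.

Definition same_row (i j : 'I_n) : bool :=
  [exists R : {set 'I_n}, [&& is_row d R, i \in R & j \in R]].

Definition darm_set (i : 'I_n) : {set 'I_n} :=
  [set j : 'I_n | (j < i) &&
     (same_row i j && (ht j <= ht i)
      || [&& adj i j, ~~ same_row i j & ht j < ht i])].
Definition dbase_pairs : {set 'I_n * 'I_n} :=
  [set p : 'I_n * 'I_n | [&& p.1 < p.2, p.2 < k & ht p.1 <= ht p.2]].
Definition darm (i : 'I_n) : nat := #|darm_set i|.

Section Stat.
Variable f : 'I_n -> nat.
Definition dDes : {set 'I_n} :=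
  [set j : 'I_n | (k <= j) && (f (dbelow j) < f j)].
Definition dInv : {set 'I_n * 'I_n} :=
  [set p : 'I_n * 'I_n | [&& p.1 < p.2, adj p.1 p.2 & f p.1 < f p.2]].
Definition dmaj : nat := \sum_(i in dDes) (dleg i).+1.
Definition dinv : int :=
  (#|dInv|%:Z - #|dbase_pairs|%:Z - (\sum_(i in dDes) darm i)%N%:Z)%R.
Definition dcoinv : int := ((\sum_(i < n | (k <= i)%N) darm i)%N%:Z - dinv)%R.
End Stat.

Definition coloring (f : {ffun 'I_n -> 'I_k}) : bool :=
  [forall i, forall j, adj i j ==> (f i != f j)]
  && [forall i : 'I_n, (i < k) ==> (f i == i :> nat)].

Definition dyck_macdonald : {mpoly Qqt[k]} :=
  (\sum_(f : {ffun 'I_n -> 'I_k} | coloring f)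
     (qvar ^+ dmaj (fun i => f i) * tvar ^ dcoinv (fun i => f i)
      * \prod_(i < n | (k <= i)%N && (f i != f (dbelow i)))
          hhl_factor (dleg i) (darm i))
     *: \prod_(i < n | (k <= i)%N) 'X_(f i))%R.

End DyckMacdonald.

Section Dyckification.
Variables (k : nat) (mu : 'I_k -> nat).

Definition label (r : nat) (i : 'I_k) : seq bool :=
  if r < mu i then [:: Estep; Nstep] else [:: Estep].

Definition labels : seq (seq bool) :=
  [seq label r i | r <- iota 0 (\max_i mu i).+1,
                   i <- [seq i <- enum 'I_k | r <= mu i]].

Definition dyckify_steps : seq bool := nseq k Nstep ++ flatten labels.

Lemma count_labels (a : pred bool) :
  count a (flatten labels) =
  \sum_(i < k) (mu i * (a Estep + a Nstep) + a Estep).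
Proof.
have -> : count a (flatten labels) = \sum_(l <- labels) count a l.
  by rewrite count_flatten sumnE big_map.
rewrite /labels big_allpairs_dep /=.
transitivity (\sum_(r <- iota 0 (\max_i mu i).+1) \sum_(i < k | r <= mu i)
   count a (label r i)).
  apply: eq_bigr => r _; rewrite big_filter -[enum _]/(enum _).
  by rewrite big_enum_cond.
rewrite (exchange_big_dep predT) //=; apply: eq_bigr => i _.
rewrite -[_ :: _]/(index_iota 0 (\max_i mu i).+1).
have le_i : mu i < (\max_i mu i).+1 by rewrite ltnS (leq_bigmax i).
rewrite (big_cat_nat (n := (mu i).+1)) //= [X in _ + X]big_nat_cond.
rewrite [X in _ + X]big_pred0 ?addn0; last first.
  by move=> r; case: (ltnP (mu i) r) => //=; rewrite andbF.
rewrite big_mkcond big_nat_recr //= leqnn /label ltnn /= addn0; congr (_ + _).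
rewrite big_nat (eq_bigr (fun=> a Estep + a Nstep)) ?sum_nat_const_nat -?big_nat.
  by rewrite sum_nat_const_nat subn0.
by move=> r /andP[_ lt_r]; rewrite lt_r (ltnW lt_r) /= addn0.
Qed.

Lemma labels_in l : l \in labels -> l = [:: Estep; Nstep] \/ l = [:: Estep].
Proof.
by case/allpairsPdep=> r [i [_ _ ->]]; rewrite /label; case: ifP; [left|right].
Qed.

Lemma labels_last : 0 < k -> exists s, labels = rcons s [:: Estep].
Proof.
move=> k_gt0; set M := \max_i mu i.
have [i0 Mi0] : {i0 | M = mu i0} by apply: eq_bigmax; rewrite card_ord.
pose B := [seq label M i | i <- [seq i <- enum 'I_k | M <= mu i]].
have defB : B = nseq (size B) [:: Estep].
  apply/all_pred1P/allP=> l /mapP[i _ ->]; rewrite /label.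
  by rewrite ltnNge (leq_bigmax i).
have sizeB : 0 < size B.
  rewrite size_map size_filter -has_count; apply/hasP; exists i0.
    by rewrite mem_enum.
  by rewrite Mi0.
have -> : labels = [seq label r i | r <- iota 0 M,
                   i <- [seq i <- enum 'I_k | r <= mu i]] ++ B.
  by rewrite /labels -/M -[M.+1]addn1 iotaD allpairs_cat /= cats0.
move: sizeB; rewrite defB size_nseq; case: (size B) => // m _.
rewrite -[m.+1]addn1 nseqD /= catA cats1; by eexists.
Qed.

Lemma suffix_labels s m :
  (forall l, l \in s -> l = [:: Estep; Nstep] \/ l = [:: Estep]) ->
  let w := flatten (rcons s [:: Estep]) in
  count_mem Nstep (drop m w) <= count_mem Estep (drop m w)
  /\ count_mem Nstep w < count_mem Estep w.
Proof.
elim: s m => [|l s IHs] m sP /=; first by case: m => [|[|m]].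
have sP' x : x \in s -> x = [:: Estep; Nstep] \/ x = [:: Estep].
  by move=> xs; apply: sP; rewrite inE xs orbT.
have [_ IH0] := IHs 0 sP'.
have [-> | ->] := sP l (mem_head _ _); rewrite /= ?add0n ?add1n; split=> //.
- case: m => [|[|m]] /=; rewrite ?add0n ?add1n ?ltnS //.
    exact: ltnW.
  by case: (IHs m sP').
- case: m => [|m] /=; rewrite ?add0n ?add1n; first by rewrite ltnW // leqW.
  by case: (IHs m sP').
- by rewrite leqW.
Qed.

Lemma dyckify_dyck : is_dyck (k + \sum_i mu i) dyckify_steps.
Proof.
have cN : count_mem Nstep dyckify_steps = k + \sum_i mu i.
  rewrite count_cat count_nseq mul1n count_labels; congr (_ + _).
  by apply: eq_bigr => i _; rewrite /= addn0 muln1.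
have cE : count_mem Estep dyckify_steps = k + \sum_i mu i.
  rewrite count_cat count_nseq mul0n add0n count_labels /=.
  rewrite big_split /= sum1_card card_ord addnC; congr (_ + _).
  by apply: eq_bigr => i _; rewrite addn0 muln1.
rewrite /is_dyck cN cE !eqxx /=; apply/forallP=> [[m _]] /=.
have [k0|k_gt0] := posnP k.
  suff -> : dyckify_steps = [::] by [].
  apply: size0nil; rewrite -(count_predC (pred1 Nstep)) cN.
  rewrite (@eq_count _ _ (pred1 Estep)); last by case.
  rewrite cE big1 ?k0 // => i _.
  by have := ltn_ord i; rewrite {2}k0.
have [s defs] := labels_last k_gt0.
rewrite /dyckify_steps take_cat size_nseq.
have [ltmk | lekm] := ltnP m k.
  by rewrite take_nseq ?(ltnW ltmk) // !count_nseq mul0n.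
set w := flatten labels; set p := m - k.
have [sufP _] : count_mem Nstep (drop p w) <= count_mem Estep (drop p w) /\ True.
  split=> //; rewrite /w defs; apply: (proj1 (suffix_labels _ _)) => l ls.
  by apply: labels_in; rewrite defs mem_rcons inE ls orbT.
move: cN cE; rewrite /dyckify_steps -/w -{1 2}(cat_take_drop p w) !count_cat.
rewrite !count_nseq /= => cN cE.
rewrite -(leq_add2r (count_mem Nstep (drop p w))) -[leqRHS]addnA cN -cE.
by rewrite addnA leq_add2l.
Qed.

Lemma dyckify_init : index Estep dyckify_steps == k.
Proof.
rewrite /dyckify_steps index_cat mem_nseq andbF size_nseq.
have [k0|k_gt0] := posnP k.
  suff -> : flatten labels = [::] by rewrite addn0.
  apply: size0nil; rewrite -count_predT count_labels big1 // => i _.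
  by have := ltn_ord i; rewrite {2}k0.
have [s defs] := labels_last k_gt0.
have : labels != [::] by rewrite defs; case: (s).
have := labels_in; case: labels => // l ls inP _.
by have [-> | ->] := inP l (mem_head _ _); rewrite /= addn0.
Qed.

Definition dyckification : dyck_path (k + \sum_i mu i) k :=
  DyckPath dyckify_dyck dyckify_init.

End Dyckification.

(* Main.v *)
(* List the boxes of the augmented diagram row by row, bottom to top and left to
   right in each row, that is against the reading order.  The height of F(mu) at
   the abscissa #|S|, for an initial segment S of this list, is the number of
   boxes which are in row 0 or directly above S.  Taking for S the predecessors
   of a box u shows that adjacency in the Dyck graph is the attacking relation;
   taking for S the union of the first r rows shows that the bounce path cuts
   the list into the rows of the diagram.  The column graph then joins each box
   to the one below it, and all statistics agree box by box. *)

Require Import Defs.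
From mathcomp Require Import all_boot all_order all_algebra zify.
From mathcomp.multinomials Require Import mpoly.

Set Implicit Arguments.
Unset Strict Implicit.
Unset Printing Implicit Defensive.

(** * Heights of lattice paths *)

Lemma on_or_belowP (d : seq bool) x y :
  reflect (exists m, count_mem Estep (take m d) = x
                     /\ y <= count_mem Nstep (take m d))
          (on_or_below d x y).
Proof.
apply: (iffP existsP) => [[m /andP[/eqP xE yN]]|[m [xE yN]]]; first by exists m.
exists (inord (minn m (size d))); rewrite inordK ?ltnS ?geq_minr //.
by rewrite take_min take_size xE eqxx.
Qed.

Lemma on_or_below_nil x y : on_or_below [::] x y = (x == 0) && (y == 0).
Proof.
by apply/on_or_belowP/andP => [[m [<-]]|[/eqP-> /eqP->]];
  [rewrite /= leqn0 | exists 0].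
Qed.

Lemma on_or_below_N d x y :
  on_or_below (Nstep :: d) x y = on_or_below d x y.-1.
Proof.
apply/on_or_belowP/on_or_belowP => [[[|m] [/= xE yN]]|[m [xE yN]]].
- by exists 0; rewrite take0; split=> //; lia.
- by exists m; case: y yN.
- by exists m.+1; case: y yN.
Qed.

Lemma on_or_below_E d x y :
  on_or_below (Estep :: d) x y =
  if x is x'.+1 then on_or_below d x' y else y == 0.
Proof.
apply/on_or_belowP/idP => [[[|m] [/= <-]]|].
- by rewrite leqn0.
- by rewrite add1n => yN; apply/on_or_belowP; exists m.
case: x => [/eqP->|x /on_or_belowP[m [<- yN]]]; first by exists 0.
by exists m.+1.
Qed.

Lemma on_or_below_nseqN c d x y :
  on_or_below (nseq c Nstep ++ d) x y = on_or_below d x (y - c).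
Proof.
by elim: c y => [|c IHc] y; rewrite /= ?subn0 // on_or_below_N IHc subnS -!subn1 subnAC.
Qed.

Lemma on_or_below_nseqE c d x y :
  on_or_below (nseq c Estep ++ d) x y =
  if x < c then y == 0 else on_or_below d (x - c) y.
Proof.
elim: c x => [|c IHc] x; rewrite /= ?subn0 // on_or_below_E.
by case: x => [//|x]; rewrite IHc ltnS subSS.
Qed.

(** Each label contains exactly one east step, so the abscissa counts the labels read, and the
    highest point at abscissa [x] comes right after the first [x] labels. *)
Lemma on_or_below_flatten (T : Type) (p : pred T) (s : seq T) x y :
  on_or_below
    (flatten [seq if p z then [:: Estep; Nstep] else [:: Estep] | z <- s]) x y
  = (x <= size s) && (y <= count p (take x s)).
Proof.
elim: s x y => [|z s IHs] x y; first by rewrite on_or_below_nil -leqn0 -[y == 0]leqn0.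
rewrite /=; case pz: (p z) => /=; rewrite on_or_below_E;
  case: x => [|x]; rewrite ?leqn0 ?on_or_below_N ?IHs ?ltnS //=.
all: by rewrite pz; case: y.
Qed.

(** * Ordered lists and their prefixes *)

Lemma take_count_pairwise (T : Type) (r : rel T) (p : pred T) (s : seq T) :
  (forall x y, r x y -> p y -> p x) -> pairwise r s ->
  take (count p s) s = filter p s.
Proof.
move=> p_lower; elim: s => //= x s IHs /andP[rx rs].
case: ifPn => px /=; first by rewrite IHs.
have np : all (predC p) s.
  by apply: sub_all rx => y rxy; apply: contra px; apply: p_lower.
move: np; rewrite all_predC has_count -eqn0Ngt => /eqP c0.
by rewrite c0 [RHS]size0nil // size_filter.
Qed.

Lemma pairwise_allpairs_dep (S R : eqType) (T : S -> eqType)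
    (f : forall x, T x -> R) (r : rel R) (s : seq S) (t : forall x, seq (T x)) :
  (forall x, x \in s -> pairwise (fun y z => r (f x y) (f x z)) (t x)) ->
  pairwise (fun x x' => all (fun y => all (fun y' => r (f x y) (f x' y')) (t x')) (t x)) s ->
  pairwise r [seq f x y | x <- s, y <- t x].
Proof.
elim: s => //= x s IHs rin /andP[/allP rx rs].
rewrite pairwise_cat pairwise_map rin ?mem_head //= IHs //; last first.
  by move=> z zs; apply: rin; rewrite inE zs orbT.
rewrite andbT; apply/allrelP => _ _ /mapP[y ty ->] /allpairsPdep[x' [y' [xs ty' ->]]].
by move/allP: (rx _ xs) => /(_ y ty)/allP; apply.
Qed.

Lemma card_ord_lt n m : m <= n -> #|[set i : 'I_n | i < m]| = m.
Proof.
move=> le_mn.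
have widen_inj : injective (widen_ord le_mn) by move=> i j /(congr1 val)/= /val_inj.
rewrite -[RHS]card_ord -(card_imset _ widen_inj); apply: eq_card => i.
rewrite inE; apply/idP/imsetP => [lt_im|[j _ ->] /=]; last exact: ltn_ord.
by exists (Ordinal lt_im) => //; apply: val_inj.
Qed.

(** * Boxes of the augmented diagram *)

Section Boxes.
Variables (k : nat) (mu : 'I_k -> nat).
Local Notation box := (box mu).
Local Notation diagram := (diagram mu).
Implicit Types (u v w : box) (S : {set box}).

Lemma brow_le u : brow u <= mu (bcol u).
Proof. by rewrite -ltnS /brow ltn_ord. Qed.

Lemma box_eq u v : brow u = brow v -> bcol u = bcol v :> nat -> u = v.
Proof.
case: u v => [i a] [j b]; rewrite /brow /bcol /= => ab /val_inj ij.
by case: j / ij b ab => b /val_inj ->.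
Qed.

(** Only meaningful for [r <= mu i]; for larger [r] the default of [inord] gives the basement
    box. *)
Definition mkbox (r : nat) (i : 'I_k) : box :=
  Tagged (fun i => 'I_(mu i).+1) (inord r : 'I_(mu i).+1).

Lemma brow_mkbox r i : r <= mu i -> brow (mkbox r i) = r.
Proof. by move=> le_r; rewrite /brow /= inordK. Qed.

Lemma mkbox_brow u : mkbox (brow u) (bcol u) = u.
Proof. by apply: box_eq; rewrite ?brow_mkbox ?brow_le. Qed.

Lemma bcol_below u : bcol (below u) = bcol u.
Proof. by []. Qed.

Lemma brow_below u : brow (below u) = (brow u).-1.
Proof. by rewrite brow_mkbox // (leq_trans (leq_pred _)) ?brow_le. Qed.

Lemma below_inj : {in diagram &, injective (@below k mu)}.
Proof.
move=> u v; rewrite !inE => u0 v0 uv; apply: box_eq.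
  by move/(congr1 (@brow _ _)): uv; rewrite !brow_below; lia.
by move/(congr1 (@bcol _ _)): uv => /(congr1 val).
Qed.

(** * The reading order and its initial segments *)

Lemma before_irr : irreflexive (@before k mu).
Proof. by move=> u; rewrite /before; lia. Qed.

Lemma before_trans : transitive (@before k mu).
Proof. by move=> v u w; rewrite /before; lia. Qed.

Lemma before_total u v : u != v -> before u v || before v u.
Proof.
apply: contra_neqT; rewrite /before => nuv; apply: box_eq; lia.
Qed.

(* Initial segments of the bottom-to-top list: [before u v] puts v below u, or
   to its left. *)
Definition lower S := forall u v, before u v -> u \in S -> v \in S.

(** The 0-based position of [u] in the bottom-to-top list, later the value of its vertex. *)
Definition idx u := #|[set v | before u v]|.

(** If [u] is in [S], its predecessors lie in [S] and miss [u]; if not, totality puts all of [S]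
    among its predecessors. Membership in an initial segment thus becomes a comparison of
    numbers. *)
Lemma idx_lower S u : lower S -> (idx u < #|S|) = (u \in S).
Proof.
move=> S_lower; apply/idP/idP => [|uS].
  apply: contraLR => uS; rewrite -leqNgt; apply/subset_leq_card/subsetP => v vS.
  rewrite inE; apply: contraNT uS => nuv.
  have [->//|ne_uv] := eqVneq u v.
  by have := before_total ne_uv; rewrite (negPf nuv) /= => /S_lower/(_ vS).
apply/proper_card/properP; split; last by exists u; rewrite // inE before_irr.
by apply/subsetP => v; rewrite inE => /S_lower; apply.
Qed.

Lemma lower_before u : lower [set v | before u v].
Proof. by move=> v w vw; rewrite !inE => uv; apply: before_trans uv vw. Qed.

Lemma idx_lt u v : (idx v < idx u) = before u v.
Proof. by rewrite (idx_lower _ (@lower_before u)) inE. Qed.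

Lemma idx_inj : injective idx.
Proof.
move=> u v uv; apply/eqP; apply: contraT => /before_total.
by rewrite -!idx_lt uv ltnn.
Qed.

Lemma card_box : #|{: box}| = k + \sum_i mu i.
Proof.
rewrite card_tagged sumnE big_map big_enum /= addnC.
under eq_bigr => i _ do rewrite card_ord -addn1.
by rewrite big_split /= sum1_card card_ord.
Qed.

Lemma row0_lower : lower (~: diagram).
Proof. by move=> u v; rewrite !inE /before; lia. Qed.

Lemma card_row0 : #|~: diagram| = k.
Proof.
have mkbox_inj : injective (mkbox 0) by move=> i j /(congr1 (@bcol _ _)).
rewrite -[RHS]card_ord -(card_imset _ mkbox_inj); apply: eq_card => u.
rewrite !inE -leqNgt leqn0; apply/idP/imsetP => [/eqP u0|[i _ ->]].
  by exists (bcol u) => //; rewrite -u0 mkbox_brow.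
by rewrite brow_mkbox.
Qed.

Lemma idx_ge_k u : (k <= idx u) = (u \in diagram).
Proof.
by rewrite leqNgt -{1}card_row0 (idx_lower _ row0_lower) !inE negbK.
Qed.

Lemma idx_row0 u : u \notin diagram -> idx u = bcol u.
Proof.
move=> u0; have mkbox_inj : injective (mkbox 0).
  by move=> i j /(congr1 (@bcol _ _)).
rewrite -[RHS](card_ord_lt (ltnW (ltn_ord (bcol u)))) -(card_imset _ mkbox_inj).
apply: eq_card => v; rewrite !inE /before in u0 *.
apply/idP/imsetP => [uv|[i + ->]].
  have v0 : brow v = 0 by lia.
  by exists (bcol v); rewrite ?inE -?v0 ?mkbox_brow //; lia.
by rewrite inE brow_mkbox //=; lia.
Qed.

(** * Height of the Dyckification over an initial segment *)

Definition up S := [set w | (brow w == 0) || (below w \in S)].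

Lemma card_up S : #|up S| = k + #|[set v in S | brow v < mu (bcol v)]|.
Proof.
(* Row 0 gives the [k]; off row 0, [below] is injective with image the boxes of [S] that are not at
   the top of their column. *)
rewrite -(cardsID diagram) addnC; congr (_ + _).
  rewrite -[RHS]card_row0; apply: eq_card => u; rewrite !inE -eqn0Ngt.
  by case: eqP.
rewrite -(card_in_imset (f := @below k mu)); last first.
  by move=> u v /setIP[_ uD] /setIP[_ vD]; apply: below_inj.
apply: eq_card => v; rewrite !inE; apply/imsetP/andP => [[u uS ->]|[vS v_lt]].
  move: uS; rewrite !inE => /andP[+ u0]; rewrite eqn0Ngt u0 /= => ->.
  by rewrite brow_below; split=> //; have := brow_le u; lia.
have vE : v = below (mkbox (brow v).+1 (bcol v)).
  by apply: box_eq; rewrite // brow_below brow_mkbox.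
by exists (mkbox (brow v).+1 (bcol v)); rewrite // !inE -vE vS brow_mkbox ?orbT.
Qed.

(** Enumerated as in [labels], so that [labels mu] is a map over this list. *)
Definition reading : seq box :=
  [seq mkbox r i | r <- iota 0 (\max_i mu i).+1,
                   i <- [seq i <- enum 'I_k | r <= mu i]].

Lemma pairwise_reading : pairwise (fun u v => before v u) reading.
Proof.
apply: pairwise_allpairs_dep => [r _|].
  rewrite -(@sorted_pairwise_in _ [pred i : 'I_k | r <= mu i]).
  - apply: (@sub_in_sorted _ [pred i : 'I_k | r <= mu i] (fun i j => i < j)).
    + by move=> i j; rewrite !inE /before => ri rj ij; rewrite !brow_mkbox //=; lia.
    + exact: filter_all.
    apply: sorted_filter => [? ? ?|]; first exact: ltn_trans.
    by have := iota_ltn_sorted 0 k; rewrite -val_enum_ord sorted_map.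
  - by move=> i j h _ _ _; apply/rev_trans/before_trans.
  exact: filter_all.
have := iota_ltn_sorted 0 (\max_i mu i).+1; rewrite (sorted_pairwise ltn_trans).
apply: sub_pairwise => r r' lt_r; apply/allP => i; rewrite mem_filter.
case/andP=> ri _; apply/allP=> j; rewrite mem_filter => /andP[rj _].
by rewrite /before !brow_mkbox // lt_r.
Qed.

Lemma mem_reading u : u \in reading.
Proof.
apply/allpairsPdep; exists (brow u), (bcol u); rewrite mkbox_brow; split=> //.
  rewrite mem_iota ltnS /= (leq_trans (brow_le u)) //.
  exact: (leq_bigmax (bcol u)).
by rewrite mem_filter brow_le mem_enum.
Qed.

Lemma perm_reading : perm_eq reading (enum box).
Proof.
apply: uniq_perm (enum_uniq _) _; last by move=> u; rewrite mem_reading mem_enum.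
by apply: pairwise_uniq pairwise_reading => u; apply: before_irr.
Qed.

Lemma count_reading (p : pred box) : count p reading = #|p|.
Proof. by rewrite (permP perm_reading) -size_filter cardE enumT. Qed.

Lemma labels_reading :
  labels mu = [seq if brow u < mu (bcol u) then [:: Estep; Nstep]
                   else [:: Estep] | u <- reading].
Proof.
rewrite map_allpairs; apply/eq_in_allpairs_dep => r _ i.
by rewrite mem_filter => /andP[ri _]; rewrite brow_mkbox.
Qed.

(** [S] fills the first [#|S|] places of [reading], so the height is [k] plus the number of labels
    [EN] in [S], which is [#|up S|] by [card_up]. *)
Lemma on_or_below_dyckify S y :
  lower S -> on_or_below (dyckify_steps mu) #|S| y = (y <= #|up S|).
Proof.
move=> S_lower; rewrite on_or_below_nseqN labels_reading.
rewrite (on_or_below_flatten (fun u : box => brow u < mu (bcol u))).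
rewrite (perm_size perm_reading) -cardT max_card /= leq_subLR card_up.
rewrite -[#|S|](count_reading (mem S)).
rewrite (take_count_pairwise _ pairwise_reading); last first.
  by move=> u v; apply: S_lower.
rewrite count_filter count_reading; congr (_ <= _ + _).
by apply: eq_card => u; rewrite !inE andbC.
Qed.

(** * Boxes as vertices, attacking as adjacency *)

Local Notation n := (k + \sum_i mu i).
Local Notation path := (dyckification mu).

Lemma lower_setT : lower [set: box].
Proof. by move=> u v _ _; rewrite inE. Qed.

Lemma idx_bound u : idx u < n.
Proof. by rewrite -card_box -cardsT (idx_lower _ lower_setT) inE. Qed.

Definition vertex u : 'I_n := Ordinal (idx_bound u).

Lemma vertex_inj : injective vertex.
Proof. by move=> u v /(congr1 val)/idx_inj. Qed.

Lemma vertex_bij : bijective vertex.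
Proof. by apply: inj_card_bij vertex_inj _; rewrite card_ord card_box. Qed.

Lemma vertexP (i : 'I_n) : exists u, i = vertex u.
Proof. by case: vertex_bij => g _ gK; exists (g i). Qed.

Lemma vertex_lt u v : (vertex u < vertex v) = before v u.
Proof. exact: idx_lt. Qed.

Lemma card_vertex (A : {set 'I_n}) S :
  (forall u, (vertex u \in A) = (u \in S)) -> #|A| = #|S|.
Proof.
move=> AS; rewrite -(on_card_preimset (onW_bij _ vertex_bij)).
by apply: eq_card => u; rewrite inE AS.
Qed.

(** Row 0 comes first in the list, and off row 0 passing to the box below preserves the order. *)
Lemma lower_up S : lower S -> lower (up S).
Proof.
move=> S_lower u v uv; rewrite !inE; case: eqP => /= [u0 _|u0 Su].
  by move: uv; rewrite /before; lia.
have [//|v0 /=] := eqVneq (brow v) 0.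
apply: S_lower Su; move: uv; rewrite /before !brow_below !bcol_below.
lia.
Qed.

(** This is the form that the path produces: among the boxes earlier in the list than [v], those
    attacking [v] come strictly after [below v], or are arbitrary when [v] is in row 0. *)
Lemma attackE u v :
  attack u v = before v u && ((brow v == 0) || before u (below v))
            || before u v && ((brow u == 0) || before v (below u)).
Proof.
rewrite /attack /low_right /before !brow_below !bcol_below.
have [->|/eqP ne_uv] /= := eqVneq u v; first by lia.
have : ~ (brow u = brow v /\ bcol u = bcol v :> nat).
  by case=> ? ?; apply: ne_uv; apply: box_eq.
lia.
Qed.

Lemma attack_sym u v : attack u v = attack v u.
Proof. by rewrite !attackE orbC. Qed.

Lemma dyck_adj_vertex u v :
  dyck_adj (dyckify_steps mu) (vertex u) (vertex v) = attack u v.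
Proof.
rewrite attackE /dyck_adj /= !idx_lt.
(* For [S] the predecessors of [w], the height at [idx w] is [#|up S|]; the successor in
   [(idx x).+1] gives [idx x < #|up S|], that is [x \in up S]. *)
have onE w x : on_or_below (dyckify_steps mu) (idx w) (idx x).+1
               = (brow x == 0) || before w (below x).
  rewrite on_or_below_dyckify; last exact: lower_before.
  by rewrite (idx_lower _ (lower_up (@lower_before w))) !inE.
by rewrite !onE.
Qed.

(** * The bounce path and the rows *)

Definition below_row r := [set u : box | brow u < r].

Lemma lower_below_row r : lower (below_row r).
Proof. by move=> u v; rewrite !inE /before; lia. Qed.

Lemma up_below_row r : up (below_row r) = below_row r.+1.
Proof. by apply/setP => u; rewrite !inE brow_below; lia. Qed.

Lemma idx_below_row u r : (idx u < #|below_row r|) = (brow u < r).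
Proof. by rewrite (idx_lower _ (@lower_below_row r)) inE. Qed.

Lemma leq_card_below_row r s : r <= s -> #|below_row r| <= #|below_row s|.
Proof.
move=> le_rs; apply/subset_leq_card/subsetP => u; rewrite !inE => ur.
exact: leq_trans le_rs.
Qed.

Lemma peak_below_row r :
  peak n (dyckify_steps mu) #|below_row r| = #|below_row r.+1|.
Proof.
have le_n : #|below_row r.+1| < n.+1 by rewrite ltnS -card_box max_card.
have onE y := on_or_below_dyckify y (@lower_below_row r).
rewrite /peak; apply/eqP; rewrite eqn_leq; apply/andP; split.
  by apply/bigmax_leqP => y; rewrite onE up_below_row.
rewrite -[leqLHS]/(nat_of_ord (Ordinal le_n)).
by apply: leq_bigmax_cond; rewrite onE up_below_row.
Qed.

(** Coordinates are relative to the diagonal point reached after [r] rows. If [u] is in row [r], its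
    abscissa falls in the first east run, at height [#|below_row r.+1|]; otherwise one bounce is
    removed and [r] grows by one. *)
Lemma on_or_below_bounce m r u y : r <= brow u < r + m ->
  on_or_below (bounce_from n (dyckify_steps mu) m #|below_row r|)
    (idx u - #|below_row r|) (y - #|below_row r|)
  = (y <= #|below_row (brow u).+1|).
Proof.
elim: m r => [|m IHm] r; first by lia.
move=> /andP[le_ru lt_u]; rewrite /= on_or_below_nseqN on_or_below_nseqE.
rewrite peak_below_row.
have le_r := leq_card_below_row (leqnSn r).
have ge_r : #|below_row r| <= idx u by rewrite leqNgt idx_below_row -leqNgt.
have -> : y - #|below_row r| - (#|below_row r.+1| - #|below_row r|)
          = y - #|below_row r.+1| by lia.
have [ur|ne_ur] := eqVneq (brow u) r.
  have lt_r : idx u < #|below_row r.+1| by rewrite idx_below_row ur.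
  by rewrite ur ltn_sub2rE // lt_r subn_eq0.
have ge_r1 : #|below_row r.+1| <= idx u.
  by rewrite leqNgt idx_below_row -leqNgt ltn_neqAle eq_sym ne_ur.
have -> : idx u - #|below_row r| - (#|below_row r.+1| - #|below_row r|)
          = idx u - #|below_row r.+1| by lia.
rewrite ltnNge leq_sub2r //=.
by apply: IHm; lia.
Qed.

(** Ensures that the [n] bounces of [bounce] reach every row. *)
Lemma brow_lt_n u : brow u < n.
Proof.
have := brow_le u; have := ltn_ord (bcol u).
by rewrite (bigD1 (bcol u)) //=; lia.
Qed.

Lemma bounce_adj_vertex u v :
  dyck_adj (bounce n (dyckify_steps mu)) (vertex u) (vertex v)
  = (u != v) && (brow u == brow v).
Proof.
have P0 : #|below_row 0| = 0 by apply: eq_card0 => w; rewrite inE.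
(* If [w] precedes [x] in the list then [brow w <= brow x], so this inequality makes adjacency mean
   equality of rows. *)
have onE w x : on_or_below (bounce n (dyckify_steps mu)) (idx w) (idx x).+1
               = (brow x <= brow w).
  have := @on_or_below_bounce n 0 w (idx x).+1.
  by rewrite P0 !subn0 leq0n add0n brow_lt_n idx_below_row ltnS => ->.
rewrite /dyck_adj /= !onE !idx_lt /before.
have [->|/eqP ne_uv] /= := eqVneq u v; first by lia.
have : ~ (brow u = brow v /\ bcol u = bcol v :> nat).
  by case=> ? ?; apply: ne_uv; apply: box_eq.
lia.
Qed.

Lemma same_row_vertex u v :
  same_row path (vertex u) (vertex v) = (brow u == brow v).
Proof.
apply/existsP/idP => [[R /and3P[/maxsetP[/forallP Rcl _] uR vR]]|uv].
  have [->//|ne_uv] := eqVneq u v.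
  move: (Rcl (vertex u)); rewrite uR => /forallP/(_ (vertex v)).
  by rewrite vR (inj_eq vertex_inj) ne_uv /= bounce_adj_vertex => /andP[].
(* Conversely, two boxes of one row form a clique, which extends to a maximal one. *)
have cl : clique (@dyck_adj n (bounce n path)) [set vertex u; vertex v].
  apply/forall_inP => x; rewrite !inE => x_uv.
  apply/forall_inP => y; rewrite !inE => y_uv; apply/implyP.
  by case/orP: x_uv => /eqP->; case/orP: y_uv => /eqP->;
    rewrite ?eqxx // (inj_eq vertex_inj) bounce_adj_vertex => ->;
    rewrite // eq_sym.
have [R Rmax /subsetP sub_R] := maxset_exists cl.
by exists R; apply/and3P; split; rewrite ?sub_R // !inE eqxx ?orbT.
Qed.

(** * The column graph: edges, legs, heights and arms *)

Lemma cedge_vertex u v :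
  cedge path (vertex u) (vertex v) = (u \in diagram) && (v == below u).
Proof.
rewrite /cedge /= dyck_adj_vertex idx_lt inE.
apply/and3P/andP => [[uv nadj /forallP between]|[u0 /eqP->]].
  have u0 : 0 < brow u.
    by move: nadj; rewrite attackE uv lt0n; apply: contra => ->.
  (* By [attackE], a non-attacking [v] other than [below u] precedes [below u], which would then
     have to attack [u], and does not. *)
  split=> //; apply: contraT => ne_v.
  have := between (vertex (below u)).
  rewrite /= !idx_lt dyck_adj_vertex.
  have := before_total ne_v; move: nadj; rewrite attackE uv /=.
  rewrite [attack _ _]attackE /before !brow_below !bcol_below; lia.
split; first by rewrite /before brow_below bcol_below; lia.
  by rewrite attackE /before !brow_below !bcol_below; lia.
apply/forallP => h; have [w ->] := vertexP h.
rewrite /= !idx_lt dyck_adj_vertex attackE /before !brow_below !bcol_below.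
lia.
Qed.

Lemma dbelow_vertex u : u \in diagram -> dbelow path (vertex u) = vertex (below u).
Proof.
move=> uD; rewrite /dbelow; case: pickP => [i|/(_ (vertex (below u)))] /=.
  by have [v ->] := vertexP i; rewrite cedge_vertex => /andP[_ /eqP->].
by rewrite cedge_vertex uD eqxx.
Qed.

Lemma connect_vertex u v :
  connect (cedge path) (vertex u) (vertex v)
  = (bcol u == bcol v) && (brow v <= brow u).
Proof.
apply/idP/andP => [/connectP[p]|[/eqP uv]].
  elim: p u => [|x p IHp] u /=; first by move=> _ /vertex_inj->.
  have [w ->] := vertexP x.
  rewrite cedge_vertex => /andP[/andP[_ /eqP->]] pth /(IHp _ pth).
  by rewrite bcol_below brow_below => -[-> ?]; split=> //; lia.
move: {2}(brow u - brow v) (erefl (brow u - brow v)) => m.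
elim: m u uv => [|m IHm] u uv um le_vu.
  suff -> : u = v by apply: connect0.
  by apply: box_eq; rewrite ?uv //; lia.
apply: connect_trans (IHm (below u) _ _ _); rewrite ?brow_below //; try lia.
by apply: connect1; rewrite cedge_vertex eqxx inE andbT; lia.
Qed.

(** Edges stay in a column; conversely all boxes of a column are joined through its basement box. *)
Lemma sconnect_vertex u v :
  connect [rel a b | cedge path a b || cedge path b a] (vertex u) (vertex v)
  = (bcol u == bcol v).
Proof.
set e := [rel a b | _]; apply/idP/eqP => [/connectP[p]|uv].
  elim: p u => [|x p IHp] u /=; first by move=> _ /vertex_inj->.
  have [w ->] := vertexP x; rewrite !cedge_vertex.
  by case/andP=> /orP[]/andP[_ /eqP->] pth /(IHp _ pth).
have e_sym : connect_sym e by apply: sym_connect_sym => x y; rewrite /= orbC.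
have down w : connect e (vertex w) (vertex (mkbox 0 (bcol w))).
  have : connect (cedge path) (vertex w) (vertex (mkbox 0 (bcol w))).
    by rewrite connect_vertex eqxx brow_mkbox.
  by apply: connect_sub => x y xy; apply: connect1; rewrite /= xy.
by apply: connect_trans (down u) _; rewrite uv e_sym.
Qed.

Lemma card_column (c : 'I_k) (p : pred nat) :
  #|[set v : box | (bcol v == c) && p (brow v)]| = #|[set a : 'I_(mu c).+1 | p a]|.
Proof.
rewrite -(card_imset _ (f := Tagged (fun i => 'I_(mu i).+1))); last first.
  move=> a b ab; apply: val_inj.
  by have := congr1 (@brow _ _) (ab : _ = _ :> box).
apply: eq_card => v; rewrite inE; apply/andP/imsetP => [[/eqP vc pv]|[a + ->]].
  by case: v vc pv => j a /=; case: c / => pa; exists a; rewrite ?inE.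
by rewrite inE.
Qed.

Lemma dleg_vertex u : dleg path (vertex u) = leg u.
Proof.
rewrite /dleg (@card_vertex _ [set v : box | (bcol v == bcol u) && (brow u < brow v)]).
  rewrite (card_column _ (fun r => brow u < r)) /leg.
  have le_u : (brow u).+1 <= (mu (bcol u)).+1 by rewrite ltnS brow_le.
  have := cardsC [set a : 'I_(mu (bcol u)).+1 | a < (brow u).+1].
  rewrite card_ord card_ord_lt // => /(canRL (addKn _)); rewrite subSS => <-.
  by apply: eq_card => a; rewrite !inE -leqNgt.
move=> v; rewrite !inE connect_vertex vertex_lt /before.
by case: (bcol v =P bcol u) => [->|_]; lia.
Qed.

(** The basement box accounts for the successor, a common shift that leaves comparisons of columns
    unchanged. *)
Lemma ht_vertex u : ht path (vertex u) = (mu (bcol u)).+1.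
Proof.
rewrite /ht (@card_vertex _ [set v : box | (bcol v == bcol u) && true]).
  rewrite (card_column _ predT) -[RHS]card_ord.
  by apply: eq_card => a; rewrite !inE.
by move=> v; rewrite !inE sconnect_vertex eq_sym andbT.
Qed.

Lemma darm_vertex u : u \in diagram -> darm path (vertex u) = arm u.
Proof.
(* The two sets counted by [arm] lie in different rows, so their union is compared with
   [darm_set]. *)
rewrite inE => u0; rewrite /arm -cardsUI (_ : _ :&: _ = set0).
  rewrite cards0 addn0; apply: card_vertex => v.
  rewrite !inE same_row_vertex dyck_adj_vertex !ht_vertex vertex_lt attackE.
  by rewrite /before !brow_below !bcol_below; lia.
by apply/setP => v; rewrite !inE; lia.
Qed.

(** * Major index and coinversions *)

Section Statistics.
Variables (f : box -> 'I_k) (g : 'I_n -> nat).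
Hypothesis gE : forall u, g (vertex u) = f u.

Lemma mem_dDes_vertex u : (vertex u \in dDes path g) = (u \in Des f).
Proof.
rewrite !inE idx_ge_k inE; case: (ltnP 0 (brow u)) => //= u0.
by rewrite dbelow_vertex ?inE // !gE.
Qed.

Lemma dmaj_vertex : dmaj path g = maj f.
Proof.
rewrite /dmaj (reindex vertex (onW_bij _ vertex_bij)).
by apply: eq_big => u; rewrite ?mem_dDes_vertex // dleg_vertex.
Qed.

Lemma sum_darm_Des :
  \sum_(i in dDes path g) darm path i = \sum_(u in Des f) arm u.
Proof.
rewrite (reindex vertex (onW_bij _ vertex_bij)).
apply: eq_big => u; rewrite mem_dDes_vertex // => /setIdP[uD _].
by rewrite darm_vertex.
Qed.

Lemma sum_darm :
  \sum_(i < n | k <= i) darm path i = \sum_(u in diagram) arm u.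
Proof.
rewrite (reindex vertex (onW_bij _ vertex_bij)).
by apply: eq_big => u; rewrite /= idx_ge_k // => /darm_vertex.
Qed.

(* Vertices increase against the reading order: [Inv] and [dInv] list the same
   pairs with their components exchanged. *)
Lemma card_dInv : #|dInv path g| = #|Inv f|.
Proof.
pose h (p : box * box) := (vertex p.2, vertex p.1).
have h_inj : injective h by move=> [u v] [u' v'] [/idx_inj-> /idx_inj->].
rewrite -(card_imset _ h_inj); apply: eq_card => -[i j].
have [u ->] := vertexP i; have [v ->] := vertexP j.
rewrite -[(_, _)]/(h (v, u)) mem_imset // !inE /= idx_lt !gE.
by rewrite dyck_adj_vertex attack_sym andbCA.
Qed.

Lemma card_dbase_pairs : #|dbase_pairs path| = #|base_pairs mu|.
Proof.
(* Columns are represented by their basement boxes, which are the first [k] vertices in order. *)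
pose h (p : 'I_k * 'I_k) := (vertex (mkbox 0 p.1), vertex (mkbox 0 p.2)).
have h_inj : injective h.
  move=> [i j] [i' j'] [].
  by move=> /idx_inj/(congr1 (@bcol _ _)) /= -> /idx_inj/(congr1 (@bcol _ _)) /= ->.
have idx_mkbox i : idx (mkbox 0 i) = i.
  by rewrite idx_row0 // inE brow_mkbox.
rewrite -(card_imset _ h_inj); apply: eq_card => -[i j].
rewrite inE; apply/and3P/imsetP => [[/=]|[[a b] + [-> ->]]]; last first.
  by rewrite !ht_vertex !inE /= !idx_mkbox ltnS ltn_ord => /andP[].
have [u ->] := vertexP i; have [v ->] := vertexP j; rewrite !ht_vertex ltnS /=.
move=> lt_uv lt_vk le_uv; have lt_uk := ltn_trans lt_uv lt_vk.
have u0 : u \notin diagram by rewrite -idx_ge_k -ltnNge.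
have v0 : v \notin diagram by rewrite -idx_ge_k -ltnNge.
exists (bcol u, bcol v); first by rewrite inE /= le_uv -!idx_row0 ?lt_uv.
have mk w : w \notin diagram -> mkbox 0 (bcol w) = w.
  by rewrite inE -eqn0Ngt => /eqP w0; rewrite -[in LHS]w0 mkbox_brow.
by rewrite /h /= !mk.
Qed.

Lemma dcoinv_vertex : dcoinv path g = coinv f.
Proof.
by rewrite /dcoinv /dinv /coinv /binv sum_darm sum_darm_Des card_dInv card_dbase_pairs.
Qed.

End Statistics.

(** * Fillings, colorings and comparison of the sums *)

Lemma augment_diagram (s : filling mu) (u : {u : box | u \in diagram}) :
  augment s (val u) = s u.
Proof. by rewrite /augment valK. Qed.

Lemma augment_row0 (s : filling mu) u : u \notin diagram -> augment s u = bcol u.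
Proof. by move=> u0; rewrite /augment insubN. Qed.

Lemma coloring_vertex (s : filling mu) (f : {ffun 'I_n -> 'I_k}) :
  (forall u, f (vertex u) = augment s u) -> coloring path f = nonattacking s.
Proof.
move=> fE; apply/andP/forallP => [[/forallP f_proper _] u|s_na].
  apply/forallP => v; rewrite -!fE -dyck_adj_vertex.
  by have /forallP := f_proper (vertex u); apply.
split.
  apply/forallP => i; apply/forallP => j.
  have [u ->] := vertexP i; have [v ->] := vertexP j.
  by rewrite dyck_adj_vertex !fE; have /forallP := s_na u; apply.
(* The prescribed values on the first [k] vertices are automatic: [augment] returns the column in
   row 0. *)
apply/forallP => i; have [u ->] := vertexP i; rewrite /= fE.
by apply/implyP; rewrite ltnNge idx_ge_k => u0; rewrite augment_row0 // idx_row0.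
Qed.

End Boxes.

Theorem proposition6p3 (k : nat) (hk : (1 <= k)%N) (mu : 'I_k -> nat) :
  macdonald mu = dyck_macdonald (dyckification mu).
Proof.
have [unvertex vK unvK] := vertex_bij mu.
pose col (s : filling mu) := [ffun i => augment s (unvertex i)].
pose fil (f : {ffun 'I_(k + \sum_i mu i) -> 'I_k}) : filling mu :=
  [ffun u => f (vertex (val u))].
have colE s u : col s (vertex u) = augment s u by rewrite ffunE vK.
(* [fil] forgets the values of [f] off the diagram; only for a coloring are they recovered by [col],
   through the condition on the first [k] vertices. *)
rewrite /dyck_macdonald (reindex_onto col fil); last first.
  move=> f /andP[_ /forallP f_base]; apply/ffunP => i; rewrite ffunE.
  rewrite -[in RHS](unvK i) /augment; case: insubP => [u _ <-|]; first by rewrite ffunE.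
  rewrite -idx_ge_k -ltnNge => lt_k; apply: val_inj.
  have := f_base (vertex (unvertex i)); rewrite /= lt_k => /eqP->.
  by rewrite idx_row0 // -idx_ge_k -ltnNge.
apply: eq_big => [s|s _].
  (* The side condition [fil (col s) == s] holds for every filling. *)
  rewrite (coloring_vertex (colE s)) -[LHS]andbT; congr (_ && _).
  apply/esym/eqP/ffunP => u.
  by rewrite ffunE colE augment_diagram.
have gE u : (fun i => nat_of_ord (col s i)) (vertex u) = augment s u.
  by rewrite colE.
rewrite (dmaj_vertex gE) (dcoinv_vertex gE); congr (_ * _ *: _)%R.
  rewrite (reindex (@vertex k mu) (onW_bij _ (vertex_bij mu))) /=.
  apply: eq_big => u.
    rewrite idx_ge_k; case uD: (u \in _) => //=.
    by rewrite dbelow_vertex // !colE.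
  by move=> /andP[uD _]; rewrite dleg_vertex darm_vertex.
rewrite (reindex (@vertex k mu) (onW_bij _ (vertex_bij mu))) /=.
rewrite [RHS](eq_bigl (mem (diagram mu))); last by move=> u; rewrite idx_ge_k.
rewrite [RHS]big_sub.
by apply: eq_bigr => u _; rewrite colE augment_diagram.
Qed.
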